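(* Let $\varphi \in \mathrm{Aut}(\mathbb{D})$ and suppose that the composition operator $C_\varphi$ is bounded on the little Bloch space $\mathcal{B}_0$. Then $C_\varphi$ is not hypercyclic on $\mathcal{B}_0$.
   Context: $\mathbb{D}=\{z\in\mathbb{C}:|z|<1\}$ and $H(\mathbb{D})$ is the space of holomorphic functions on $\mathbb{D}$. $\mathrm{Aut}(\mathbb{D})$ is the set of one-to-one holomorphic maps of $\mathbb{D}$ onto itself. For a holomorphic self-map $\varphi$ of $\mathbb{D}$, $C_\varphi f=f\circ\varphi$ for $f\in H(\mathbb{D})$. The Bloch space is $\mathcal{B}=\{f\in H(\mathbb{D}):\|f\|_{\mathcal{B}}=\sup_{z\in\mathbb{D}}(1-|z|^2)|f'(z)|<\infty\}$; the little Bloch space is $\mathcal{B}_0=\{f\in\mathcal{B}:\lim_{|z|\to1}(1-|z|^2)|f'(z)|=0\}$. Both carry the complete norm $\|f\|_{Bloch}=|f(0)|+\|f\|_{\mathcal{B}}$. ''$C_\varphi$ is bounded on $\mathcal{B}_0$'' means that $C_\varphi$ is a bounded linear operator from $\mathcal{B}_0$ to $\mathcal{B}_0$. A continuous linear operator $T$ on a separable infinite-dimensional Banach space $X$ is hypercyclic if there is $f\in X$ whose orbit $\{T^nf:n=0,1,2,\dots\}$ is dense in $X$. *)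

(* Defs.v *)
From Stdlib Require Import Reals Lra FunctionalExtensionality ProofIrrelevance.
From Coquelicot Require Import Coquelicot.

Open Scope R_scope.

Definition disc (z : C) : Prop := Cmod z < 1.

Definition holomorphic (f : C -> C) : Prop :=
  forall z : C, disc z -> @ex_derive C_AbsRing C_NormedModule f z.

(* Aut(D): only the values of phi on the disc matter. *)
Definition disc_automorphism (phi : C -> C) : Prop :=
  holomorphic phi /\
  (forall z : C, disc z -> disc (phi z)) /\
  (forall z w : C, disc z -> disc w -> phi z = phi w -> z = w) /\
  (forall w : C, disc w -> exists z : C, disc z /\ phi z = w).

(* [C_derive f z] is f'(z) as soon as f is complex differentiable at z
   ([C_derive_correct]); it is only used for holomorphic f and z in the disc. *)
Definition bloch_weight (f : C -> C) (z : C) : R :=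
  (1 - Cmod z ^ 2) * Cmod (C_derive f z).

Definition bloch_sup (f : C -> C) : Rbar :=
  Lub_Rbar (fun x : R => exists z : C, disc z /\ x = bloch_weight f z).

Definition bloch (f : C -> C) : Prop :=
  holomorphic f /\ Rbar_lt (bloch_sup f) p_infty.

Definition little_bloch (f : C -> C) : Prop :=
  bloch f /\
  forall eps : posreal, exists r : R, r < 1 /\
    forall z : C, disc z -> r < Cmod z -> bloch_weight f z < eps.

(* Real-valued version of [bloch_sup]; meaningful when [bloch f] holds. *)
Definition bloch_seminorm (f : C -> C) : R := real (bloch_sup f).

Definition bloch_norm (f : C -> C) : R :=
  Cmod (f (RtoC 0)) + bloch_seminorm f.

(* A function on the disc is represented by its extension by 0 to C, so that
   Leibniz equality of elements is equality of functions on the disc. *)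
Record B0 : Type := mkB0 {
  B0_fun :> C -> C;
  B0_little_bloch : little_bloch B0_fun;
  B0_outside : forall z : C, ~ disc z -> B0_fun z = RtoC 0
}.

Lemma B0_ext (f g : B0) : (forall z : C, f z = g z) -> f = g.
Proof.
destruct f as [f hf of], g as [g hg og]; simpl; intros H.
assert (E : f = g) by (apply functional_extensionality; exact H).
subst g; f_equal; apply proof_irrelevance.
Qed.

Lemma disc_0 : disc (RtoC 0).
Proof. unfold disc; rewrite Cmod_0; lra. Qed.

Lemma disc_weight_pos (z : C) : disc z -> 0 < 1 - Cmod z ^ 2.
Proof. unfold disc; intros H; generalize (Cmod_ge_0 z); nra. Qed.

Lemma bloch_weight_ge0 (f : C -> C) (z : C) : disc z -> 0 <= bloch_weight f z.
Proof.
intros H; apply Rmult_le_pos.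
- apply Rlt_le, disc_weight_pos, H.
- apply Cmod_ge_0.
Qed.

Lemma bloch_sup_le (f : C -> C) (M : R) :
  (forall z : C, disc z -> bloch_weight f z <= M) -> Rbar_le (bloch_sup f) M.
Proof.
intros H; apply (proj2 (Lub_Rbar_correct _)).
intros x [z [Hz ->]]; exact (H z Hz).
Qed.

Lemma bloch_sup_ub (f : C -> C) (z : C) :
  disc z -> Rbar_le (bloch_weight f z) (bloch_sup f).
Proof. intros H; apply (proj1 (Lub_Rbar_correct _)); exists z; auto. Qed.

Lemma bloch_sup_fin (f : C -> C) :
  bloch f -> Finite (bloch_seminorm f) = bloch_sup f.
Proof.
intros [_ H]; unfold bloch_seminorm.
generalize (bloch_sup_ub f _ disc_0).
destruct (bloch_sup f); simpl in *; tauto.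
Qed.

Lemma bloch_weight_le (f : C -> C) (z : C) :
  bloch f -> disc z -> bloch_weight f z <= bloch_seminorm f.
Proof.
intros H Hz; generalize (bloch_sup_ub f z Hz); now rewrite <- bloch_sup_fin.
Qed.

Lemma bloch_seminorm_le (f : C -> C) (M : R) : bloch f ->
  (forall z : C, disc z -> bloch_weight f z <= M) -> bloch_seminorm f <= M.
Proof.
intros H HM; generalize (bloch_sup_le f M HM); now rewrite <- bloch_sup_fin.
Qed.

Lemma bloch_of_bound (f : C -> C) (M : R) : holomorphic f ->
  (forall z : C, disc z -> bloch_weight f z <= M) -> bloch f.
Proof.
intros H HM; split; [exact H|].
apply Rbar_le_lt_trans with (Finite M); [apply bloch_sup_le, HM | exact I].
Qed.

Lemma bloch_seminorm_ge0 (f : C -> C) : bloch f -> 0 <= bloch_seminorm f.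
Proof.
intros H; apply Rle_trans with (bloch_weight f (RtoC 0)).
- apply bloch_weight_ge0, disc_0.
- apply bloch_weight_le; [exact H | exact disc_0].
Qed.

Lemma bloch_norm_ge0 (f : C -> C) : bloch f -> 0 <= bloch_norm f.
Proof.
intros H; unfold bloch_norm.
generalize (Cmod_ge_0 (f (RtoC 0))) (bloch_seminorm_ge0 f H); lra.
Qed.

Lemma is_C_derive_plus (f g : C -> C) (z l m : C) :
  @is_derive C_AbsRing C_NormedModule f z l ->
  @is_derive C_AbsRing C_NormedModule g z m ->
  @is_derive C_AbsRing C_NormedModule (fun w => Cplus (f w) (g w)) z (Cplus l m).
Proof. exact (@is_derive_plus C_AbsRing C_NormedModule f g z l m). Qed.

Lemma is_C_derive_scal (k : C) (f : C -> C) (z l : C) :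
  @is_derive C_AbsRing C_NormedModule f z l ->
  @is_derive C_AbsRing C_NormedModule (fun w => Cmult k (f w)) z (Cmult k l).
Proof.
intros H; unfold is_derive.
apply (filterdiff_ext_lin (K := C_AbsRing)
  (U := AbsRing_NormedModule C_AbsRing) (V := C_NormedModule))
  with (fun y : C => Cmult k (Cmult y l)).
- exact (filterdiff_scal_r_fct (K := C_AbsRing)
    (U := AbsRing_NormedModule C_AbsRing) (V := C_NormedModule) k f
    (fun y => scal y l) (F := @locally (AbsRing_UniformSpace C_AbsRing) z)
    Cmult_comm H).
- intros y; change (Cmult k (Cmult y l) = Cmult y (Cmult k l)); ring.
Qed.

Lemma is_C_derive_0 (z : C) :
  @is_derive C_AbsRing C_NormedModule (fun _ => RtoC 0) z (RtoC 0).
Proof. exact (@is_derive_const C_AbsRing C_NormedModule (RtoC 0) z). Qed.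

Lemma holomorphic_derive (f : C -> C) (z : C) : holomorphic f -> disc z ->
  @is_derive C_AbsRing C_NormedModule f z (C_derive f z).
Proof.
intros H Hz; apply C_derive_correct; [exact (RtoC 0) | exact (H z Hz)].
Qed.

Lemma holomorphic_plus (f g : C -> C) : holomorphic f -> holomorphic g ->
  holomorphic (fun z => Cplus (f z) (g z)).
Proof.
intros Hf Hg z Hz; eexists; apply is_C_derive_plus; now apply holomorphic_derive.
Qed.

Lemma holomorphic_scal (k : C) (f : C -> C) : holomorphic f ->
  holomorphic (fun z => Cmult k (f z)).
Proof.
intros Hf z Hz; eexists; apply is_C_derive_scal; now apply holomorphic_derive.
Qed.

Lemma bloch_weight_plus (f g : C -> C) (z : C) :
  holomorphic f -> holomorphic g -> disc z ->
  bloch_weight (fun w => Cplus (f w) (g w)) z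
  <= bloch_weight f z + bloch_weight g z.
Proof.
intros Hf Hg Hz; unfold bloch_weight.
rewrite (is_C_derive_unique _ z (Cplus (C_derive f z) (C_derive g z))).
- generalize (Cmod_triangle (C_derive f z) (C_derive g z)) (disc_weight_pos z Hz).
  nra.
- apply is_C_derive_plus; now apply holomorphic_derive.
Qed.

Lemma bloch_weight_scal (k : C) (f : C -> C) (z : C) :
  holomorphic f -> disc z ->
  bloch_weight (fun w => Cmult k (f w)) z = Cmod k * bloch_weight f z.
Proof.
intros Hf Hz; unfold bloch_weight.
rewrite (is_C_derive_unique _ z (Cmult k (C_derive f z))).
- rewrite Cmod_mult; ring.
- apply is_C_derive_scal; now apply holomorphic_derive.
Qed.

Lemma bloch_plus (f g : C -> C) : bloch f -> bloch g ->
  bloch (fun z => Cplus (f z) (g z)).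
Proof.
intros Hf Hg; apply bloch_of_bound with (bloch_seminorm f + bloch_seminorm g).
- apply holomorphic_plus; [apply Hf | apply Hg].
- intros z Hz; generalize (bloch_weight_plus f g z (proj1 Hf) (proj1 Hg) Hz)
    (bloch_weight_le f z Hf Hz) (bloch_weight_le g z Hg Hz); lra.
Qed.

Lemma bloch_scal (k : C) (f : C -> C) : bloch f ->
  bloch (fun z => Cmult k (f z)).
Proof.
intros Hf; apply bloch_of_bound with (Cmod k * bloch_seminorm f).
- apply holomorphic_scal, Hf.
- intros z Hz; rewrite bloch_weight_scal by (trivial; apply Hf).
  apply Rmult_le_compat_l; [apply Cmod_ge_0 | now apply bloch_weight_le].
Qed.

Lemma little_bloch_plus (f g : C -> C) : little_bloch f -> little_bloch g ->
  little_bloch (fun z => Cplus (f z) (g z)).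
Proof.
intros [Hf Lf] [Hg Lg]; split; [now apply bloch_plus|].
intros eps; destruct (Lf (pos_div_2 eps)) as [r [r1 Hr]].
destruct (Lg (pos_div_2 eps)) as [s [s1 Hs]].
exists (Rmax r s); split; [now apply Rmax_lub_lt|].
intros z Hz Hrs.
assert (Hr' := Hr z Hz (Rle_lt_trans _ _ _ (Rmax_l r s) Hrs)).
assert (Hs' := Hs z Hz (Rle_lt_trans _ _ _ (Rmax_r r s) Hrs)).
generalize (bloch_weight_plus f g z (proj1 Hf) (proj1 Hg) Hz).
simpl in Hr', Hs'; lra.
Qed.

Lemma little_bloch_scal (k : C) (f : C -> C) : little_bloch f ->
  little_bloch (fun z => Cmult k (f z)).
Proof.
intros [Hf Lf]; split; [now apply bloch_scal|].
intros eps.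
assert (P : 0 < eps / (Cmod k + 1)).
{ apply Rdiv_lt_0_compat; [apply cond_pos | generalize (Cmod_ge_0 k); lra]. }
destruct (Lf (mkposreal _ P)) as [r [r1 Hr]].
exists r; split; [exact r1|]; intros z Hz Hrz.
rewrite bloch_weight_scal by (trivial; apply Hf).
generalize (Hr z Hz Hrz) (bloch_weight_ge0 f z Hz) (Cmod_ge_0 k); simpl.
intros H1 H2 H3.
assert (E : eps / (Cmod k + 1) * (Cmod k + 1) = eps) by (field; lra).
nra.
Qed.

Lemma little_bloch_0 : little_bloch (fun _ => RtoC 0).
Proof.
assert (W : forall z, bloch_weight (fun _ => RtoC 0) z = 0).
{ intros z; unfold bloch_weight.
  assert (E : C_derive (fun _ => RtoC 0) z = RtoC 0)
    by exact (is_C_derive_unique _ z _ (is_C_derive_0 z)).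
  rewrite E, Cmod_0; ring. }
split.
- apply bloch_of_bound with 0.
  + intros z _; eexists; apply is_C_derive_0.
  + intros z _; rewrite W; apply Rle_refl.
- intros eps; exists 0; split; [lra|].
  intros z _ _; rewrite W; apply cond_pos.
Qed.

Definition B0_zero : B0 :=
  mkB0 (fun _ => RtoC 0) little_bloch_0 (fun _ _ => eq_refl).

Lemma B0_plus_outside (f g : B0) (z : C) :
  ~ disc z -> Cplus (f z) (g z) = RtoC 0.
Proof. intros H; rewrite !B0_outside by exact H; ring. Qed.

Definition B0_plus (f g : B0) : B0 :=
  mkB0 (fun z => Cplus (f z) (g z))
    (little_bloch_plus f g (B0_little_bloch f) (B0_little_bloch g))
    (B0_plus_outside f g).

Lemma B0_scal_outside (k : C) (f : B0) (z : C) :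
  ~ disc z -> Cmult k (f z) = RtoC 0.
Proof. intros H; rewrite B0_outside by exact H; ring. Qed.

Definition B0_scal (k : C) (f : B0) : B0 :=
  mkB0 (fun z => Cmult k (f z)) (little_bloch_scal k f (B0_little_bloch f))
    (B0_scal_outside k f).

Definition B0_opp (f : B0) : B0 := B0_scal (Copp (RtoC 1)) f.

Lemma B0_plus_comm (f g : B0) : B0_plus f g = B0_plus g f.
Proof. apply B0_ext; intros z; simpl; ring. Qed.

Lemma B0_plus_assoc (f g h : B0) :
  B0_plus f (B0_plus g h) = B0_plus (B0_plus f g) h.
Proof. apply B0_ext; intros z; simpl; ring. Qed.

Lemma B0_plus_zero (f : B0) : B0_plus f B0_zero = f.
Proof. apply B0_ext; intros z; simpl; ring. Qed.

Lemma B0_plus_opp (f : B0) : B0_plus f (B0_opp f) = B0_zero.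
Proof. apply B0_ext; intros z; simpl; ring. Qed.

Definition B0_AbelianMonoid_mixin : AbelianMonoid.mixin_of B0 :=
  AbelianMonoid.Mixin B0 B0_plus B0_zero
    B0_plus_comm B0_plus_assoc B0_plus_zero.

Canonical B0_AbelianMonoid : AbelianMonoid :=
  AbelianMonoid.Pack B0 B0_AbelianMonoid_mixin B0.

Definition B0_AbelianGroup_mixin : AbelianGroup.mixin_of B0_AbelianMonoid :=
  AbelianGroup.Mixin B0_AbelianMonoid B0_opp B0_plus_opp.

Canonical B0_AbelianGroup : AbelianGroup :=
  AbelianGroup.Pack B0
    (AbelianGroup.Class B0 B0_AbelianMonoid_mixin B0_AbelianGroup_mixin) B0.

Lemma B0_scal_assoc (x y : C) (f : B0) :
  B0_scal x (B0_scal y f) = B0_scal (Cmult x y) f.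
Proof. apply B0_ext; intros z; simpl; ring. Qed.

Lemma B0_scal_one (f : B0) : B0_scal (RtoC 1) f = f.
Proof. apply B0_ext; intros z; simpl; ring. Qed.

Lemma B0_scal_plus_r (x : C) (f g : B0) :
  B0_scal x (B0_plus f g) = B0_plus (B0_scal x f) (B0_scal x g).
Proof. apply B0_ext; intros z; simpl; ring. Qed.

Lemma B0_scal_plus_l (x y : C) (f : B0) :
  B0_scal (Cplus x y) f = B0_plus (B0_scal x f) (B0_scal y f).
Proof. apply B0_ext; intros z; simpl; ring. Qed.

Definition B0_ModuleSpace_mixin : ModuleSpace.mixin_of C_Ring B0_AbelianGroup :=
  ModuleSpace.Mixin C_Ring B0_AbelianGroup B0_scal
    B0_scal_assoc B0_scal_one B0_scal_plus_r B0_scal_plus_l.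

Definition B0_ModuleSpace_class : ModuleSpace.class_of C_Ring B0 :=
  ModuleSpace.Class C_Ring B0 (AbelianGroup.class B0_AbelianGroup)
    B0_ModuleSpace_mixin.

Canonical B0_ModuleSpace : ModuleSpace C_Ring :=
  ModuleSpace.Pack C_Ring B0 B0_ModuleSpace_class B0.

Definition B0_norm (f : B0) : R := bloch_norm f.

Lemma B0_bloch (f : B0) : bloch f.
Proof. apply B0_little_bloch. Qed.

Lemma B0_norm_triangle (f g : B0) :
  B0_norm (B0_plus f g) <= B0_norm f + B0_norm g.
Proof.
unfold B0_norm, bloch_norm; simpl.
assert (H : bloch_seminorm (fun z => Cplus (f z) (g z))
            <= bloch_seminorm f + bloch_seminorm g).
{ apply bloch_seminorm_le; [apply bloch_plus; apply B0_bloch|].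
  intros z Hz.
  generalize
    (bloch_weight_plus f g z (proj1 (B0_bloch f)) (proj1 (B0_bloch g)) Hz)
    (bloch_weight_le f z (B0_bloch f) Hz) (bloch_weight_le g z (B0_bloch g) Hz).
  lra. }
generalize (Cmod_triangle (f (RtoC 0)) (g (RtoC 0))); lra.
Qed.

Lemma B0_norm_scal (k : C) (f : B0) :
  B0_norm (B0_scal k f) <= Cmod k * B0_norm f.
Proof.
unfold B0_norm, bloch_norm; simpl.
assert (H : bloch_seminorm (fun z => Cmult k (f z))
            <= Cmod k * bloch_seminorm f).
{ apply bloch_seminorm_le; [apply bloch_scal; apply B0_bloch|].
  intros z Hz; rewrite bloch_weight_scal by (trivial; apply B0_bloch).
  apply Rmult_le_compat_l; [apply Cmod_ge_0|].
  apply bloch_weight_le; [apply B0_bloch | exact Hz]. }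
rewrite Cmod_mult; lra.
Qed.

Lemma B0_norm_zero : B0_norm B0_zero = 0.
Proof.
apply Rle_antisym; [|apply bloch_norm_ge0, B0_bloch].
replace B0_zero with (B0_scal (RtoC 0) B0_zero)
  by (apply B0_ext; intros z; simpl; ring).
generalize (B0_norm_scal (RtoC 0) B0_zero); rewrite Cmod_0; lra.
Qed.

Lemma B0_norm_opp_le (f : B0) : B0_norm (B0_opp f) <= B0_norm f.
Proof.
generalize (B0_norm_scal (Copp (RtoC 1)) f).
rewrite Cmod_opp, Cmod_1; unfold B0_opp; lra.
Qed.

Definition B0_ball (f : B0) (eps : R) (g : B0) : Prop :=
  B0_norm (minus g f) < eps.

Lemma B0_ball_center (f : B0) (eps : posreal) : B0_ball f eps f.
Proof.
unfold B0_ball; rewrite minus_eq_zero.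
change (B0_norm B0_zero < eps); rewrite B0_norm_zero; apply cond_pos.
Qed.

Lemma B0_ball_sym (f g : B0) (eps : R) : B0_ball f eps g -> B0_ball g eps f.
Proof.
unfold B0_ball; intros H; rewrite <- opp_minus.
apply Rle_lt_trans with (2 := H); apply B0_norm_opp_le.
Qed.

Lemma B0_ball_triangle (f g h : B0) (e1 e2 : R) :
  B0_ball f e1 g -> B0_ball g e2 h -> B0_ball f (e1 + e2) h.
Proof.
unfold B0_ball; intros H1 H2; rewrite (minus_trans g).
apply Rle_lt_trans with (B0_norm (minus h g) + B0_norm (minus g f)); [|lra].
apply B0_norm_triangle.
Qed.

Definition B0_UniformSpace_mixin : UniformSpace.mixin_of B0 :=
  UniformSpace.Mixin B0 B0_zero B0_ball
    B0_ball_center B0_ball_sym B0_ball_triangle.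

Canonical B0_UniformSpace : UniformSpace :=
  UniformSpace.Pack B0 B0_UniformSpace_mixin B0.

Definition B0_NormedModuleAux_class : NormedModuleAux.class_of C_AbsRing B0 :=
  NormedModuleAux.Class C_AbsRing B0 B0_ModuleSpace_class B0_UniformSpace_mixin.

Canonical B0_NormedModuleAux : NormedModuleAux C_AbsRing :=
  NormedModuleAux.Pack C_AbsRing B0 B0_NormedModuleAux_class B0.

Lemma segment_is_derive_0 (f : C -> C) (z : C) (t : R) :
  @is_derive C_AbsRing C_NormedModule f (Cmult (RtoC t) z) (RtoC 0) ->
  @is_derive R_AbsRing C_R_NormedModule (fun s => f (Cmult (RtoC s) z)) t zero.
Proof.
intros [_ H].
assert (HM : 0 < Cmod z + 1) by (generalize (Cmod_ge_0 z); lra).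
split; [apply is_linear_scal_l|].
intros x Hx.
assert (E : t = x)
  by exact (is_filter_lim_locally_unique (V := R_NormedModule) t x Hx).
subst x.
intros eps.
assert (P : 0 < eps / (Cmod z + 1))
  by (apply Rdiv_lt_0_compat; [apply cond_pos | exact HM]).
destruct (H (Cmult (RtoC t) z) (fun P HP => HP) (mkposreal _ P)) as [d Hd].
assert (Pd : 0 < d / (Cmod z + 1))
  by (apply Rdiv_lt_0_compat; [apply cond_pos | exact HM]).
exists (mkposreal _ Pd); intros s Hs.
change (Rabs (s - t) < d / (Cmod z + 1)) in Hs.
assert (Es : Cmod (Cminus (Cmult (RtoC s) z) (Cmult (RtoC t) z))
             = Rabs (s - t) * Cmod z).
{ rewrite <- Cmod_R, <- Cmod_mult; f_equal; rewrite RtoC_minus; ring. }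
assert (Hd' := Hd (Cmult (RtoC s) z)).
change (Cmod (Cminus (Cmult (RtoC s) z) (Cmult (RtoC t) z)) < d ->
  Cmod (Cminus (Cminus (f (Cmult (RtoC s) z)) (f (Cmult (RtoC t) z)))
    (Cmult (Cminus (Cmult (RtoC s) z) (Cmult (RtoC t) z)) (RtoC 0)))
  <= eps / (Cmod z + 1)
     * Cmod (Cminus (Cmult (RtoC s) z) (Cmult (RtoC t) z))) in Hd'.
rewrite Es in Hd'.
assert (Ed : d / (Cmod z + 1) * (Cmod z + 1) = d) by (field; lra).
assert (Ee : eps / (Cmod z + 1) * (Cmod z + 1) = eps) by (field; lra).
generalize (Cmod_ge_0 z) (Rabs_pos (s - t)); intros Hz Hst.
change (@norm R_AbsRing C_R_NormedModule
  (Cminus (Cminus (f (Cmult (RtoC s) z)) (f (Cmult (RtoC t) z)))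
    ((s - t) * 0, (s - t) * 0)%R) <= eps * Rabs (s - t)).
rewrite <- Cmod_norm, Rmult_0_r.
match type of Hd' with _ -> Cmod ?x <= _ =>
  replace x with (Cminus (Cminus (f (Cmult (RtoC s) z)) (f (Cmult (RtoC t) z)))
    (RtoC 0)) in Hd' by ring
end.
apply Rle_trans with (eps / (Cmod z + 1) * (Rabs (s - t) * Cmod z)).
- apply Hd'; apply Rle_lt_trans with (Rabs (s - t) * (Cmod z + 1)); [nra|].
  rewrite <- Ed; apply Rmult_lt_compat_r; assumption.
- simpl in P; rewrite <- Ee at 2.
  assert (0 <= eps / (Cmod z + 1) * Rabs (s - t))
    by (apply Rmult_le_pos; lra).
  nra.
Qed.

Lemma disc_constant (f : C -> C) (z : C) : holomorphic f ->
  (forall w : C, disc w -> C_derive f w = RtoC 0) -> disc z ->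
  f z = f (RtoC 0).
Proof.
intros Hf H0 Hz.
assert (E : f (Cmult (RtoC 0) z) = f (Cmult (RtoC 1) z)).
{ apply (eq_is_derive (V := C_R_NormedModule) (fun s => f (Cmult (RtoC s) z)));
    [|lra].
  intros t Ht; apply segment_is_derive_0.
  assert (Ht' : disc (Cmult (RtoC t) z)).
  { unfold disc in *; rewrite Cmod_mult, Cmod_R, Rabs_pos_eq by lra.
    generalize (Cmod_ge_0 z); nra. }
  rewrite <- (H0 _ Ht'); apply holomorphic_derive; assumption. }
rewrite Cmult_0_l, Cmult_1_l in E; symmetry; exact E.
Qed.

Lemma B0_norm_eq0 (f : B0) : B0_norm f = 0 -> f = B0_zero.
Proof.
unfold B0_norm, bloch_norm; intros H.
generalize (Cmod_ge_0 (f (RtoC 0))) (bloch_seminorm_ge0 f (B0_bloch f)).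
intros H1 H2; apply B0_ext; intros z; simpl.
destruct (Rlt_dec (Cmod z) 1) as [Hz | Hz]; [|now apply B0_outside].
rewrite disc_constant; [|apply B0_bloch| |exact Hz].
- apply Cmod_eq_0; lra.
- intros w Hw; apply Cmod_eq_0.
  generalize (bloch_weight_le f w (B0_bloch f) Hw) (disc_weight_pos w Hw)
    (Cmod_ge_0 (C_derive f w)); unfold bloch_weight; nra.
Qed.

Lemma B0_norm_ball (f g : B0) (eps : R) :
  B0_norm (minus g f) < eps -> B0_ball f eps g.
Proof. intros H; exact H. Qed.

Lemma B0_ball_norm (f g : B0) (eps : posreal) :
  B0_ball f eps g -> B0_norm (minus g f) < 1 * eps.
Proof. rewrite Rmult_1_l; intros H; exact H. Qed.

Definition B0_NormedModule_mixin :
  NormedModule.mixin_of C_AbsRing B0_NormedModuleAux :=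
  NormedModule.Mixin C_AbsRing B0_NormedModuleAux B0_norm 1
    B0_norm_triangle B0_norm_scal B0_norm_ball B0_ball_norm B0_norm_eq0.

(* The little Bloch space with the norm |f(0)| + sup (1 - |z|^2) |f'(z)|. *)
Canonical B0_NormedModule : NormedModule C_AbsRing :=
  NormedModule.Pack C_AbsRing B0
    (NormedModule.Class C_AbsRing B0 B0_NormedModuleAux_class
      B0_NormedModule_mixin) B0.

(* [T] is the operator f |-> f o phi on the little Bloch space; in particular
   f o phi is in the little Bloch space for every f in it. *)
Definition is_composition_operator (phi : C -> C) (T : B0 -> B0) : Prop :=
  forall (f : B0) (z : C), disc z -> T f z = f (phi z).

Definition dense {X : UniformSpace} (A : X -> Prop) : Prop :=
  forall (g : X) (eps : posreal), exists f : X, A f /\ ball g eps f.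

Definition hypercyclic {K : AbsRing} {X : NormedModule K} (T : X -> X) : Prop :=
  exists f : X, dense (fun g : X => exists n : nat, g = Nat.iter n T f).

(* Main.v *)
Require Import Defs.
From Stdlib Require Import Reals Lra.
From Coquelicot Require Import Coquelicot.

(** The Schwarz-Pick inequality
    (1 - |z|^2) |phi'(z)| <= 1 - |phi(z)|^2 gives
    (1 - |z|^2) |(f o phi)'(z)| <= (1 - |phi(z)|^2) |f'(phi(z))|, so that
    composition with phi does not increase the Bloch seminorm
    ([composition_contracts_seminorm]).  Hence the whole orbit of f stays in
    the set of functions of seminorm at most S, the seminorm of f.  Such a set
    is not dense: the function (S + 1) z has weight S + 1 at the origin, and
    the weight at a point is 1-Lipschitz for the norm ([B0_weight_near]), so no
    point of the orbit is at distance less than 1 from (S + 1) z.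

    The substance is [schwarz_pick].  Moebius maps reduce it to the bound
    |h'(0)| <= 1 for a holomorphic self-map h of the disc that fixes 0
    ([schwarz_derivative]).  There, q(z) = h(z)/z is holomorphic off the origin,
    so its mean over the circle |z| = r is independent of r
    ([circle_integral_constant]).  It tends to h'(0) as r -> 0, and it is at
    most 1/r in modulus, which tends to 1 as r -> 1.

    Holomorphy means pointwise complex differentiability, the derivative being
    possibly discontinuous a priori, so the independence of r cannot be had by
    differentiating under the integral sign.  It comes from Goursat's theorem on
    rectangles ([goursat]), proved by bisection and applied to q(exp z), whose
    integrals over the two horizontal sides of [s1, s2] x [0, 2 pi] cancel by
    periodicity. *)

(** * Complex derivatives *)

Notation is_C_derive := (@is_derive C_AbsRing C_NormedModule).
Notation ex_C_derive := (@ex_derive C_AbsRing C_NormedModule).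

Lemma is_C_derive_eps (f : C -> C) (z l : C) :
  is_C_derive f z l <->
  forall eps, 0 < eps -> exists d, 0 < d /\ forall w, Cmod (w - z) < d ->
    Cmod (f w - f z - l * (w - z)) <= eps * Cmod (w - z).
Proof.
split.
- intros [_ H] eps He.
  destruct (H z (fun P HP => HP) (mkposreal eps He)) as [d Hd].
  exists d; split; [apply cond_pos|]; intros w Hw.
  rewrite (Cmult_comm l); exact (Hd w Hw).
- intros H; split; [apply is_linear_scal_l|].
  intros x Hx.
  assert (E : z = x) by exact (is_filter_lim_locally_unique
    (V := AbsRing_NormedModule C_AbsRing) z x Hx).
  subst x; intros eps.
  destruct (H eps (cond_pos eps)) as [d [Hd Hw]].
  exists (mkposreal d Hd); intros w Hzw.
  generalize (Hw w Hzw); rewrite (Cmult_comm l); intros R; exact R.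
Qed.

Lemma is_C_derive_ext_near (f g : C -> C) (z l : C) (r : R) : 0 < r ->
  (forall w, Cmod (w - z) < r -> f w = g w) ->
  is_C_derive f z l -> is_C_derive g z l.
Proof.
intros Hr E Hf; apply is_C_derive_eps; intros eps He.
destruct (proj1 (is_C_derive_eps f z l) Hf eps He) as [d [Hd H]].
exists (Rmin d r); split; [now apply Rmin_glb_lt|]; intros w Hw.
assert (Cmod (w - z) < d) by (apply Rlt_le_trans with (1 := Hw), Rmin_l).
assert (Cmod (w - z) < r) by (apply Rlt_le_trans with (1 := Hw), Rmin_r).
rewrite <- (E w), <- (E z); [now apply H| |assumption].
replace (z - z)%C with (RtoC 0) by ring; now rewrite Cmod_0.
Qed.

Lemma is_C_derive_continuous (f : C -> C) (z l : C) : is_C_derive f z l ->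
  forall eps, 0 < eps -> exists d, 0 < d /\
    forall w, Cmod (w - z) < d -> Cmod (f w - f z) < eps.
Proof.
intros Hf eps He.
destruct (proj1 (is_C_derive_eps f z l) Hf 1 Rlt_0_1) as [d [Hd H]].
assert (Hl := Cmod_ge_0 l).
assert (Hq : 0 < eps / (2 + Cmod l)) by (apply Rdiv_lt_0_compat; lra).
exists (Rmin d (eps / (2 + Cmod l))); split; [now apply Rmin_glb_lt|].
intros w Hw.
assert (H1 : Cmod (w - z) < d) by (apply Rlt_le_trans with (1 := Hw), Rmin_l).
assert (H2 : Cmod (w - z) < eps / (2 + Cmod l))
  by (apply Rlt_le_trans with (1 := Hw), Rmin_r).
specialize (H w H1).
replace (f w - f z)%C with ((f w - f z - l * (w - z)) + l * (w - z))%C by ring.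
apply Rle_lt_trans with (1 := Cmod_triangle _ _); rewrite Cmod_mult.
assert (H3 : Cmod (w - z) * (2 + Cmod l) < eps).
{ replace eps with (eps / (2 + Cmod l) * (2 + Cmod l)) at 1 by (field; lra).
  apply Rmult_lt_compat_r; lra. }
generalize (Cmod_ge_0 (w - z)); nra.
Qed.

(** The complex numbers carry two uniform structures, one from the absolute
    value and one as a product of two copies of the reals; general theorems on
    derivatives of scalar functions speak of the former.  The two notions of
    derivative differ only in the space in which linearity of the differential
    is expressed. *)
Lemma is_C_derive_AbsRing (f : C -> C) (z l : C) :
  is_C_derive f z l <->
  @is_derive C_AbsRing (AbsRing_NormedModule C_AbsRing) f z l.
Proof. split; intros [_ H]; (split; [apply is_linear_scal_l | exact H]). Qed.

Lemma is_C_derive_id (z : C) : is_C_derive (fun w => w) z (RtoC 1).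
Proof. apply is_C_derive_AbsRing; exact (@is_derive_id C_AbsRing z). Qed.

Lemma is_C_derive_const (k z : C) : is_C_derive (fun _ => k) z (RtoC 0).
Proof. exact (@is_derive_const C_AbsRing C_NormedModule k z). Qed.

Lemma is_C_derive_eq (f : C -> C) (z l m : C) :
  is_C_derive f z l -> l = m -> is_C_derive f z m.
Proof. now intros H <-. Qed.

Lemma is_C_derive_minus (f g : C -> C) (z l m : C) :
  is_C_derive f z l -> is_C_derive g z m ->
  is_C_derive (fun w => f w - g w)%C z (l - m)%C.
Proof. exact (@is_derive_minus C_AbsRing C_NormedModule f g z l m). Qed.

Lemma is_C_derive_mult (f g : C -> C) (z l m : C) :
  is_C_derive f z l -> is_C_derive g z m ->
  is_C_derive (fun w => f w * g w)%C z (l * g z + f z * m)%C.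
Proof.
intros Hf Hg; apply is_C_derive_AbsRing in Hf; apply is_C_derive_AbsRing in Hg.
apply is_C_derive_AbsRing.
exact (is_derive_mult (K := C_AbsRing) f g z l m Hf Hg Cmult_comm).
Qed.

Lemma is_C_derive_comp (f g : C -> C) (z l m : C) :
  is_C_derive f (g z) l -> is_C_derive g z m ->
  is_C_derive (fun w => f (g w)) z (m * l)%C.
Proof.
intros Hf Hg; apply is_C_derive_AbsRing in Hg.
exact (is_derive_comp (K := C_AbsRing) (V := C_NormedModule) f g z l m Hf Hg).
Qed.

Lemma Cmod_minus_ge (z w : C) : Cmod z - Cmod (w - z) <= Cmod w.
Proof.
generalize (Cmod_triangle w (- (w - z))); rewrite Cmod_opp.
replace (w + - (w - z))%C with z by ring; lra.
Qed.

(** 1/w - 1/z + (w - z)/z^2 = (w - z)^2 / (z^2 w), and |w| >= |z|/2 as soon as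
    |w - z| <= |z|/2. *)
Lemma is_C_derive_inv (z : C) : z <> RtoC 0 ->
  is_C_derive Cinv z (- / (z * z))%C.
Proof.
intros Hz; apply is_C_derive_eps; intros eps He.
assert (Pz := proj1 (Cmod_gt_0 z) Hz).
set (r := Cmod z) in *.
assert (Pd : 0 < eps * r ^ 3 / 2)
  by (apply Rdiv_lt_0_compat; [apply Rmult_lt_0_compat; [|apply pow_lt]|]; lra).
exists (Rmin (r / 2) (eps * r ^ 3 / 2)); split; [apply Rmin_glb_lt; lra|].
intros w Hw.
assert (H1 := Rlt_le_trans _ _ _ Hw (Rmin_l _ _)).
assert (H2 := Rlt_le_trans _ _ _ Hw (Rmin_r _ _)).
assert (H3 : r / 2 <= Cmod w) by (generalize (Cmod_minus_ge z w); fold r; lra).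
assert (Hw0 : w <> RtoC 0) by (apply Cmod_gt_0; lra).
replace (/ w - / z - - / (z * z) * (w - z))%C
  with ((w - z) * (w - z) * / (z * z * w))%C
  by (field; split; assumption).
rewrite !Cmod_mult, Cmod_inv, !Cmod_mult; [fold r |].
2: { intros E; apply Cmod_gt_0 in Hw0; apply Cmod_gt_0 in Hz.
     assert (Cmod (z * z * w) = 0) by (rewrite E; apply Cmod_0).
     rewrite !Cmod_mult in H.
     generalize (Rmult_lt_0_compat _ _ (Rmult_lt_0_compat _ _ Hz Hz) Hw0); lra. }
rewrite (Rmult_comm eps), Rmult_assoc.
apply Rmult_le_compat_l; [apply Cmod_ge_0|].
assert (Q : 0 < r * r * Cmod w) by (apply Rmult_lt_0_compat; nra).
apply Rmult_le_reg_r with (1 := Q).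
rewrite Rmult_assoc, Rinv_l, Rmult_1_r by lra.
apply Rlt_le, Rlt_le_trans with (1 := H2).
replace (eps * r ^ 3 / 2) with (eps * (r * r * (r / 2))) by field.
apply Rmult_le_compat_l; [lra|]; apply Rmult_le_compat_l; nra.
Qed.

(** * The complex exponential *)

Definition Cexp (z : C) : C :=
  (exp (Re z) * cos (Im z), exp (Re z) * sin (Im z)).

Lemma Cexp_plus (z w : C) : Cexp (z + w) = (Cexp z * Cexp w)%C.
Proof.
destruct z as [a b], w as [u v]; unfold Cexp, Cmult; simpl.
rewrite exp_plus, cos_plus, sin_plus; f_equal; ring.
Qed.

Lemma Cmod_Cexp (z : C) : Cmod (Cexp z) = exp (Re z).
Proof.
assert (P := exp_pos (Re z)).
unfold Cmod, Cexp; cbn [fst snd].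
replace ((exp (Re z) * cos (Im z)) ^ 2 + (exp (Re z) * sin (Im z)) ^ 2)
  with (Rsqr (exp (Re z))).
- apply sqrt_Rsqr; lra.
- generalize (sin2_cos2 (Im z)); unfold Rsqr; intros E.
  replace ((exp (Re z) * cos (Im z)) ^ 2 + (exp (Re z) * sin (Im z)) ^ 2)
    with (exp (Re z) * exp (Re z)
      * (sin (Im z) * sin (Im z) + cos (Im z) * cos (Im z))) by ring.
  rewrite E; ring.
Qed.

Lemma Cmod_le_Re_Im (z : C) : Cmod z <= Rabs (Re z) + Rabs (Im z).
Proof.
destruct z as [a b]; simpl.
replace (a, b) with (RtoC a + Ci * RtoC b)%C
  by (unfold Cplus, Cmult, RtoC; simpl; f_equal; ring).
apply Rle_trans with (1 := Cmod_triangle _ _).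
rewrite Cmod_mult, Cmod_Ci, !Cmod_R; lra.
Qed.

Lemma im_le_Cmod (z : C) : Rabs (Im z) <= Cmod z.
Proof. apply Rle_trans with (2 := Rmax_Cmod z), Rmax_r. Qed.

Lemma derivable_pt_lim_0_eps (f : R -> R) (l : R) : derivable_pt_lim f 0 l ->
  forall eps, 0 < eps -> exists d, 0 < d /\ forall h, Rabs h < d ->
    Rabs (f h - f 0 - l * h) <= eps * Rabs h.
Proof.
intros H eps He; destruct (H eps He) as [d Hd].
exists d; split; [apply cond_pos|]; intros h Hh.
destruct (Req_dec h 0) as [-> | Hn].
- rewrite Rmult_0_r, !Rminus_diag, Rabs_R0; lra.
- specialize (Hd h Hn Hh); rewrite Rplus_0_l in Hd.
  replace (f h - f 0 - l * h) with (((f h - f 0) / h - l) * h) by (field; exact Hn).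
  rewrite Rabs_mult; apply Rmult_le_compat_r; [apply Rabs_pos | lra].
Qed.

(** With w = u + iv, both coordinates of e^w - 1 - w are combinations of
    e^u - 1 - u, cos v - 1, sin v - v and the product (e^u - 1) v, all of them
    small compared with |w| by the real derivatives at 0. *)
Lemma is_C_derive_Cexp_0 : is_C_derive Cexp (RtoC 0) (RtoC 1).
Proof.
apply is_C_derive_eps; intros eps0 He0.
(* Each of the errors below costs a multiple of eps, for a total of 9 eps. *)
set (eps := Rmin 1 (eps0 / 9)).
assert (He : 0 < eps) by (apply Rmin_glb_lt; lra).
assert (He1 : eps <= 1) by apply Rmin_l.
assert (He2 : eps <= eps0 / 9) by apply Rmin_r.
clearbody eps.
assert (D1 := derivable_pt_lim_exp 0); rewrite exp_0 in D1.
assert (D2 := derivable_pt_lim_cos 0); rewrite sin_0 in D2.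
assert (D3 := derivable_pt_lim_sin 0); rewrite cos_0 in D3.
destruct (derivable_pt_lim_0_eps _ _ D1 eps He) as [d1 [P1 L1]].
destruct (derivable_pt_lim_0_eps _ _ D2 eps He) as [d2 [P2 L2]].
destruct (derivable_pt_lim_0_eps _ _ D3 eps He) as [d3 [P3 L3]].
exists (Rmin (Rmin d1 d2) (Rmin d3 eps)).
split; [repeat apply Rmin_glb_lt; assumption|]; intros [u v] Hw.
replace ((u, v) - 0)%C with ((u, v) : C) in *
  by (unfold Cminus, Cplus, Copp, RtoC; simpl; f_equal; ring).
assert (Hu := re_le_Cmod (u, v)); assert (Hv := im_le_Cmod (u, v)).
simpl in Hu, Hv; set (m := Cmod (u, v)) in *.
assert (m < d1 /\ m < d2 /\ m < d3 /\ m < eps) as [M1 [M2 [M3 M4]]].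
{ repeat split; apply Rlt_le_trans with (1 := Hw).
  - apply Rle_trans with (1 := Rmin_l _ _), Rmin_l.
  - apply Rle_trans with (1 := Rmin_l _ _), Rmin_r.
  - apply Rle_trans with (1 := Rmin_r _ _), Rmin_l.
  - apply Rle_trans with (1 := Rmin_r _ _), Rmin_r. }
specialize (L1 u (Rle_lt_trans _ _ _ Hu M1)); rewrite exp_0 in L1.
specialize (L2 v (Rle_lt_trans _ _ _ Hv M2)); rewrite cos_0 in L2.
specialize (L3 v (Rle_lt_trans _ _ _ Hv M3)); rewrite sin_0 in L3.
assert (X0 := exp_pos u).
assert (X3 : exp u <= 3).
{ apply Rle_trans with (2 := exp_le_3).
  apply Rlt_le, exp_increasing; generalize (Rle_abs u); lra. }
apply Rle_trans with (1 := Cmod_le_Re_Im _).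
apply Rle_trans with (9 * eps * m).
2: { apply Rmult_le_compat_r; [apply Cmod_ge_0 | lra]. }
replace (Re (Cexp (u, v) - Cexp 0 - 1 * (u, v)))
  with ((exp u - 1 - 1 * u) + exp u * (cos v - 1 - - 0 * v))
  by (unfold Cexp; simpl; rewrite exp_0, cos_0; ring).
replace (Im (Cexp (u, v) - Cexp 0 - 1 * (u, v)))
  with (exp u * (sin v - 0 - 1 * v) + ((exp u - 1 - 1 * u) + u) * v)
  by (unfold Cexp; simpl; rewrite exp_0, sin_0; ring).
assert (A1 := Rabs_triang (exp u - 1 - 1 * u) (exp u * (cos v - 1 - - 0 * v))).
assert (A2 := Rabs_triang (exp u * (sin v - 0 - 1 * v))
  (((exp u - 1 - 1 * u) + u) * v)).
assert (A3 := Rabs_triang (exp u - 1 - 1 * u) u).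
rewrite Rabs_mult, (Rabs_pos_eq (exp u)) in A1 by lra.
rewrite !Rabs_mult, (Rabs_pos_eq (exp u)) in A2 by lra.
set (E := Rabs (exp u - 1 - 1 * u)) in *.
set (K := Rabs (cos v - 1 - - 0 * v)) in *.
set (S := Rabs (sin v - 0 - 1 * v)) in *.
set (Q := Rabs (exp u - 1 - 1 * u + u)) in *.
assert (U := Rabs_pos u); assert (V := Rabs_pos v).
assert (B1 : exp u * K <= 3 * (eps * m)).
{ apply Rmult_le_compat; [lra | apply Rabs_pos | exact X3 |].
  apply Rle_trans with (1 := L2); apply Rmult_le_compat_l; lra. }
assert (B2 : exp u * S <= 3 * (eps * m)).
{ apply Rmult_le_compat; [lra | apply Rabs_pos | exact X3 |].
  apply Rle_trans with (1 := L3); apply Rmult_le_compat_l; lra. }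
assert (B3 : E <= eps * m)
  by (apply Rle_trans with (1 := L1); apply Rmult_le_compat_l; lra).
assert (B4 : Q <= 2 * eps) by nra.
assert (B5 : Q * Rabs v <= 2 * eps * m)
  by (apply Rmult_le_compat; [apply Rabs_pos | lra | lra | exact Hv]).
lra.
Qed.

(** The addition formula transports the derivative at 0 to z. *)
Lemma is_C_derive_Cexp (z : C) : is_C_derive Cexp z (Cexp z).
Proof.
apply is_C_derive_ext_near with (fun w => Cexp z * Cexp (w - z))%C 1.
- lra.
- intros w _; rewrite <- Cexp_plus; f_equal; ring.
- apply is_C_derive_eq with (Cexp z * ((1 - 0) * 1))%C; [|ring].
  apply is_C_derive_scal.
  apply (is_C_derive_comp Cexp (fun w => w - z)%C).
  + replace (z - z)%C with (RtoC 0) by ring; exact is_C_derive_Cexp_0.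
  + apply is_C_derive_minus; [apply is_C_derive_id | apply is_C_derive_const].
Qed.

(** * Integrals of complex-valued functions of a real variable *)

Notation CInt := (@RInt C_R_CompleteNormedModule).
Notation ex_CInt := (@ex_RInt C_R_NormedModule).

Lemma ex_CInt_continuous (g : R -> C) (a b : R) : a <= b ->
  (forall x, a <= x <= b -> forall eps, 0 < eps -> exists d, 0 < d /\
     forall y, Rabs (y - x) < d -> Cmod (g y - g x) < eps) ->
  ex_CInt g a b.
Proof.
intros Hab H; apply (ex_RInt_continuous (V := C_R_CompleteNormedModule)).
intros x; rewrite Rmin_left, Rmax_right by exact Hab; intros Hx.
apply (filterlim_locally_ball_norm (K := R_AbsRing) (U := C_R_NormedModule)).
intros eps; destruct (H x Hx eps (cond_pos eps)) as [d [Hd Hy]].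
exists (mkposreal d Hd); intros y Hxy.
unfold ball_norm; rewrite <- Cmod_norm; exact (Hy y Hxy).
Qed.

Lemma CInt_ext (f g : R -> C) (a b : R) :
  (forall x, f x = g x) -> CInt f a b = CInt g a b.
Proof.
intros E; exact (RInt_ext (V := C_R_CompleteNormedModule) f g a b
  (fun x _ => E x)).
Qed.

Lemma CInt_Chasles (g : R -> C) (a b c : R) : ex_CInt g a b -> ex_CInt g b c ->
  CInt g a c = (CInt g a b + CInt g b c)%C.
Proof.
intros H1 H2; symmetry.
exact (RInt_Chasles (V := C_R_CompleteNormedModule) g a b c H1 H2).
Qed.

Lemma CInt_plus (f g : R -> C) (a b : R) : ex_CInt f a b -> ex_CInt g a b ->
  CInt (fun x => f x + g x)%C a b = (CInt f a b + CInt g a b)%C.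
Proof. exact (RInt_plus (V := C_R_CompleteNormedModule) f g a b). Qed.

Lemma ex_CInt_minus (f g : R -> C) (a b : R) : ex_CInt f a b -> ex_CInt g a b ->
  ex_CInt (fun x => f x - g x)%C a b.
Proof. exact (ex_RInt_minus (V := C_R_NormedModule) f g a b). Qed.

(** In the proof of Goursat's theorem the integrand is an increment of an affine
    function, hence a constant, up to a small error; this is the estimate that
    is needed there. *)
Lemma CInt_near_const (g : R -> C) (a b : R) (k : C) (M : R) : a <= b ->
  ex_CInt g a b -> (forall x, a <= x <= b -> Cmod (g x - k) <= M) ->
  Cmod (CInt g a b - RtoC (b - a) * k) <= (b - a) * M.
Proof.
intros Hab Hg HM.
assert (H := is_RInt_minus (V := C_R_NormedModule) _ _ a b _ _
  (RInt_correct (V := C_R_CompleteNormedModule) g a b Hg)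
  (is_RInt_const (V := C_R_NormedModule) a b k)).
rewrite Cmod_norm.
replace (CInt g a b - RtoC (b - a) * k)%C
  with (@minus C_R_NormedModule (CInt g a b) (scal (b - a) k)).
- apply (norm_RInt_le_const (V := C_R_NormedModule)) with (1 := Hab) (3 := H).
  intros x Hx; rewrite <- Cmod_norm; exact (HM x Hx).
- change (CInt g a b - ((b - a) * fst k, (b - a) * snd k)%R
    = CInt g a b - RtoC (b - a) * k)%C.
  f_equal; unfold Cmult, RtoC; simpl; f_equal; ring.
Qed.

Lemma Cmod_CInt_le (g : R -> C) (a b M : R) : a <= b -> ex_CInt g a b ->
  (forall x, a <= x <= b -> Cmod (g x) <= M) -> Cmod (CInt g a b) <= (b - a) * M.
Proof.
intros Hab Hg HM.
replace (CInt g a b) with (CInt g a b - RtoC (b - a) * 0)%C by ring.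
apply CInt_near_const; [exact Hab | exact Hg|].
intros x Hx; replace (g x - 0)%C with (g x) by ring; now apply HM.
Qed.

(** * Goursat's theorem on a rectangle *)

(** The integral of G(z) dz along the boundary of [a, b] x [c, d], with opposite
    sides paired: on an affine function each integrand is then constant. *)
Definition rect_integral (G : C -> C) (a b c d : R) : C :=
  (CInt (fun x => G (x, c) - G (x, d)) a b
   + Ci * CInt (fun y => G (b, y) - G (a, y)) c d)%C.

Definition differentiable_on_rect (G : C -> C) (a b c d : R) : Prop :=
  forall x y, a <= x <= b -> c <= y <= d -> ex_C_derive G (x, y).

Lemma differentiable_on_subrect (G : C -> C) (a b c d a' b' c' d' : R) :
  a <= a' -> b' <= b -> c <= c' -> d' <= d ->
  differentiable_on_rect G a b c d -> differentiable_on_rect G a' b' c' d'.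
Proof. intros A B C D H x y Hx Hy; apply H; lra. Qed.

Lemma Cmod_horizontal (x x' y : R) : Cmod ((x', y) - (x, y)) = Rabs (x' - x).
Proof.
replace ((x', y) - (x, y))%C with (RtoC (x' - x))
  by (unfold Cminus, Cplus, Copp, RtoC; simpl; f_equal; ring).
apply Cmod_R.
Qed.

Lemma Cmod_vertical (x y y' : R) : Cmod ((x, y') - (x, y)) = Rabs (y' - y).
Proof.
replace ((x, y') - (x, y))%C with (Ci * RtoC (y' - y))%C
  by (unfold Cminus, Cplus, Copp, Cmult, Ci, RtoC; simpl; f_equal; ring).
rewrite Cmod_mult, Cmod_Ci, Cmod_R; ring.
Qed.

Lemma ex_CInt_horizontal (G : C -> C) (a b c d y : R) : a <= b -> c <= y <= d ->
  differentiable_on_rect G a b c d -> ex_CInt (fun x => G (x, y)) a b.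
Proof.
intros Hab Hy H; apply ex_CInt_continuous; [exact Hab|].
intros x Hx eps He; destruct (H x y Hx Hy) as [l Hl].
destruct (is_C_derive_continuous G _ l Hl eps He) as [r [Hr Hw]].
exists r; split; [exact Hr|]; intros x' Hx'; apply Hw.
now rewrite Cmod_horizontal.
Qed.

Lemma ex_CInt_vertical (G : C -> C) (a b c d x : R) : c <= d -> a <= x <= b ->
  differentiable_on_rect G a b c d -> ex_CInt (fun y => G (x, y)) c d.
Proof.
intros Hcd Hx H; apply ex_CInt_continuous; [exact Hcd|].
intros y Hy eps He; destruct (H x y Hx Hy) as [l Hl].
destruct (is_C_derive_continuous G _ l Hl eps He) as [r [Hr Hw]].
exists r; split; [exact Hr|]; intros y' Hy'; apply Hw.
now rewrite Cmod_vertical.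
Qed.

Lemma rect_integral_split_x (G : C -> C) (a m b c d : R) :
  a <= m <= b -> c <= d -> differentiable_on_rect G a b c d ->
  rect_integral G a b c d = (rect_integral G a m c d + rect_integral G m b c d)%C.
Proof.
intros Hm Hcd H; unfold rect_integral.
assert (H1 : differentiable_on_rect G a m c d)
  by (apply differentiable_on_subrect with a b c d; trivial; lra).
assert (H2 : differentiable_on_rect G m b c d)
  by (apply differentiable_on_subrect with a b c d; trivial; lra).
rewrite (CInt_Chasles _ a m b).
2, 3: apply ex_CInt_minus; apply ex_CInt_horizontal with c d; trivial; lra.
replace (CInt (fun y => G (b, y) - G (a, y))%C c d) with
  (CInt (fun y => G (m, y) - G (a, y)) c d
   + CInt (fun y => G (b, y) - G (m, y)) c d)%C; [ring|].
rewrite <- CInt_plus.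
2, 3: apply ex_CInt_minus; apply ex_CInt_vertical with a b; trivial; lra.
apply CInt_ext; intros y; ring.
Qed.

Lemma rect_integral_split_y (G : C -> C) (a b c m d : R) :
  a <= b -> c <= m <= d -> differentiable_on_rect G a b c d ->
  rect_integral G a b c d = (rect_integral G a b c m + rect_integral G a b m d)%C.
Proof.
intros Hab Hm H; unfold rect_integral.
assert (H1 : differentiable_on_rect G a b c m)
  by (apply differentiable_on_subrect with a b c d; trivial; lra).
assert (H2 : differentiable_on_rect G a b m d)
  by (apply differentiable_on_subrect with a b c d; trivial; lra).
rewrite (CInt_Chasles _ c m d).
2, 3: apply ex_CInt_minus; apply ex_CInt_vertical with a b; trivial; lra.
replace (CInt (fun x => G (x, c) - G (x, d))%C a b) with
  (CInt (fun x => G (x, c) - G (x, m)) a b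
   + CInt (fun x => G (x, m) - G (x, d)) a b)%C; [ring|].
rewrite <- CInt_plus.
2, 3: apply ex_CInt_minus; apply ex_CInt_horizontal with c d; trivial; lra.
apply CInt_ext; intros x; ring.
Qed.

(** The affine part A + l z of G contributes
    -(b - a) i l (d - c) + i (d - c) l (b - a) = 0 to the boundary integral.  The
    remainder is at most eta D on the rectangle, and the half-perimeter is at
    most D. *)
Lemma rect_integral_small (G : C -> C) (a b c d x y : R) (l : C) (eta D : R) :
  a <= x <= b -> c <= y <= d -> differentiable_on_rect G a b c d ->
  0 <= eta -> (b - a) + (d - c) <= D ->
  (forall w, Cmod (w - (x, y)) <= D ->
     Cmod (G w - G (x, y) - l * (w - (x, y))) <= eta * Cmod (w - (x, y))) ->
  Cmod (rect_integral G a b c d) <= 2 * eta * D ^ 2.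
Proof.
intros Hx Hy H He HD Hw.
assert (Hab : a <= b) by lra; assert (Hcd : c <= d) by lra.
assert (B : forall x' y', a <= x' <= b -> c <= y' <= d ->
  Cmod (G (x', y') - G (x, y) - l * ((x', y') - (x, y))) <= eta * D).
{ intros x' y' Hx' Hy'.
  assert (E : Cmod ((x', y') - (x, y)) <= D).
  { apply Rle_trans with (1 := Cmod_le_Re_Im _); simpl.
    apply Rle_trans with (2 := HD); apply Rplus_le_compat;
      apply Rabs_le; lra. }
  apply Rle_trans with (1 := Hw _ E); apply Rmult_le_compat_l; assumption. }
assert (Hh : Cmod (CInt (fun x' => G (x', c) - G (x', d))%C a b
    - RtoC (b - a) * (- (Ci * l * RtoC (d - c)))) <= (b - a) * (2 * (eta * D))).
{ apply CInt_near_const; [exact Hab| |].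
  - apply ex_CInt_minus; apply ex_CInt_horizontal with c d; trivial; lra.
  - intros x' Hx'.
    replace (G (x', c) - G (x', d) - - (Ci * l * RtoC (d - c)))%C
      with ((G (x', c) - G (x, y) - l * ((x', c) - (x, y)))
        + - (G (x', d) - G (x, y) - l * ((x', d) - (x, y))))%C.
    + apply Rle_trans with (1 := Cmod_triangle _ _); rewrite Cmod_opp.
      generalize (B x' c Hx' ltac:(lra)) (B x' d Hx' ltac:(lra)); lra.
    + replace (Ci * l * RtoC (d - c))%C with (l * ((x', d) - (x', c)))%C; [ring|].
      rewrite <- Cmult_assoc, (Cmult_comm Ci), <- Cmult_assoc; f_equal.
      unfold Cminus, Cplus, Copp, Cmult, Ci, RtoC; simpl; f_equal; ring. }
assert (Hv : Cmod (CInt (fun y' => G (b, y') - G (a, y'))%C c d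
    - RtoC (d - c) * (l * RtoC (b - a))) <= (d - c) * (2 * (eta * D))).
{ apply CInt_near_const; [exact Hcd| |].
  - apply ex_CInt_minus; apply ex_CInt_vertical with a b; trivial; lra.
  - intros y' Hy'.
    replace (G (b, y') - G (a, y') - l * RtoC (b - a))%C
      with ((G (b, y') - G (x, y) - l * ((b, y') - (x, y)))
        + - (G (a, y') - G (x, y) - l * ((a, y') - (x, y))))%C.
    + apply Rle_trans with (1 := Cmod_triangle _ _); rewrite Cmod_opp.
      generalize (B b y' ltac:(lra) Hy') (B a y' ltac:(lra) Hy'); lra.
    + replace (RtoC (b - a)) with ((b, y') - (a, y'))%C; [ring|].
      unfold Cminus, Cplus, Copp, RtoC; simpl; f_equal; ring. }
unfold rect_integral.
set (I1 := CInt _ a b) in *; set (I2 := CInt _ c d) in *.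
replace (I1 + Ci * I2)%C with
  ((I1 - RtoC (b - a) * (- (Ci * l * RtoC (d - c))))
   + Ci * (I2 - RtoC (d - c) * (l * RtoC (b - a))))%C by ring.
apply Rle_trans with (1 := Cmod_triangle _ _).
rewrite Cmod_mult, Cmod_Ci, Rmult_1_l.
apply Rle_trans with (((b - a) + (d - c)) * (2 * (eta * D))); [lra|].
replace (2 * eta * D ^ 2) with (D * (2 * (eta * D))) by ring.
apply Rmult_le_compat_r; [|exact HD].
apply Rmult_le_pos; [lra | apply Rmult_le_pos; lra].
Qed.

(** If P failed on the unit square, it would fail on one quarter of it, on one
    quarter of that quarter, and so on.  The nested squares shrink to a point
    (p, q), around which P holds on all small squares.  Decidability of P makes
    the sequence of squares a plain recursion, with no choice principle.
    [P u v t] is about the square [u, u + t] x [v, v + t]. *)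
Lemma square_bisection (P : R -> R -> R -> Prop) :
  (forall u v t, {P u v t} + {~ P u v t}) ->
  (forall u v t, 0 < t -> 0 <= u -> u + t <= 1 -> 0 <= v -> v + t <= 1 ->
     P u v (t / 2) -> P (u + t / 2) v (t / 2) ->
     P u (v + t / 2) (t / 2) -> P (u + t / 2) (v + t / 2) (t / 2) -> P u v t) ->
  (forall p q, 0 <= p <= 1 -> 0 <= q <= 1 -> exists d, 0 < d /\
     forall u v t, 0 < t < d -> 0 <= u -> u + t <= 1 -> 0 <= v -> v + t <= 1 ->
       u <= p <= u + t -> v <= q <= v + t -> P u v t) ->
  P 0 0 1.
Proof.
intros dec Hsplit Hloc.
destruct (dec 0 0 1) as [H01 | H01]; [exact H01|]; exfalso.
(* Some quarter of a bad square is bad; when the other three are good, the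
   last one is taken untested. *)
pose (next := fun (s : R * R) (t : R) =>
  let (u, v) := s in
  if dec u v (t / 2) then
    if dec (u + t / 2) v (t / 2) then
      if dec u (v + t / 2) (t / 2) then (u + t / 2, v + t / 2)
      else (u, v + t / 2)
    else (u + t / 2, v)
  else (u, v)).
pose (sq := fix sq n := match n with
  O => (0, 0) | S k => next (sq k) ((/ 2) ^ k) end).
pose (U := fun n => fst (sq n)); pose (V := fun n => snd (sq n)).
assert (T : forall n, 0 < (/ 2) ^ n) by (intros n; apply pow_lt; lra).
assert (Step : forall n, U n <= U (S n) /\ V n <= V (S n)
  /\ U (S n) + (/ 2) ^ S n <= U n + (/ 2) ^ n
  /\ V (S n) + (/ 2) ^ S n <= V n + (/ 2) ^ n).
{ intros n; unfold U, V; simpl; generalize (T n); destruct (sq n) as [u v].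
  simpl; intros Tn.
  repeat (match goal with |- context [dec ?a ?b ?c] => destruct (dec a b c) end);
    simpl; lra. }
assert (Inv : forall n, ~ P (U n) (V n) ((/ 2) ^ n)
  /\ 0 <= U n /\ U n + (/ 2) ^ n <= 1 /\ 0 <= V n /\ V n + (/ 2) ^ n <= 1).
{ induction n as [|n [IH B]].
  - unfold U, V; simpl; repeat split; try lra; exact H01.
  - split; [|generalize (Step n); lra].
    generalize IH B (T n); unfold U, V; simpl.
    destruct (sq n) as [u v]; simpl; clear IH B; intros IH B Tn.
    replace (/ 2 * (/ 2) ^ n) with ((/ 2) ^ n / 2) by (unfold Rdiv; ring).
    repeat (match goal with |- context [dec ?a ?b ?c] => destruct (dec a b c) end);
      simpl; trivial.
    intros Q; apply IH, Hsplit; trivial; lra. }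
assert (LT : is_lim_seq (fun n => (/ 2) ^ n) 0)
  by (apply is_lim_seq_geom; rewrite Rabs_pos_eq; lra).
assert (Lim : forall W : nat -> R, (forall n, W n <= W (S n)) ->
  (forall n, W (S n) + (/ 2) ^ S n <= W n + (/ 2) ^ n) ->
  exists p, forall n, W n <= p <= W n + (/ 2) ^ n).
{ intros W Wi Wd.
  assert (W1 : forall n, W n + (/ 2) ^ n <= W 0%nat + 1)
    by (induction n as [|n IH]; [simpl; lra | generalize (Wd n); lra]).
  destruct (ex_finite_lim_seq_incr W (W 0%nat + 1) Wi) as [p Hp].
  { intros n; generalize (W1 n) (T n); lra. }
  exists p; intros n; split; [now apply is_lim_seq_incr_compare|].
  apply (is_lim_seq_decr_compare (fun k => W k + (/ 2) ^ k)); [|exact Wd].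
  replace (Finite p) with (Rbar_plus p 0) by (simpl; f_equal; ring).
  apply is_lim_seq_plus'; assumption. }
destruct (Lim U) as [p Hp]; [intros n; apply Step | intros n; apply Step|].
destruct (Lim V) as [q Hq]; [intros n; apply Step | intros n; apply Step|].
destruct (Hloc p q) as [d [Hd HP]].
{ generalize (Hp 0%nat) (Inv 0%nat); lra. }
{ generalize (Hq 0%nat) (Inv 0%nat); lra. }
destruct (LT (fun t => t < d)) as [N HN].
{ exists (mkposreal d Hd); intros t Ht.
  apply Rle_lt_trans with (Rabs (t - 0)); [rewrite Rminus_0_r; apply Rle_abs|].
  exact Ht. }
destruct (Inv N) as [NP B]; apply NP, HP; try apply B;
  [|apply Hp | apply Hq].
split; [apply T | exact (HN N (le_n N))].
Qed.

(** Bisection in affine coordinates, for the property that the boundary integral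
    over a subrectangle scaled by t is at most eps t^2 in modulus.  It is stable
    under gluing four quarters since 4 eps (t/2)^2 = eps t^2, and it holds near
    each point by differentiability.  Using a copy of the unit square keeps the
    aspect ratio fixed, so that diameter times perimeter is of the order of
    t^2. *)
Lemma goursat (G : C -> C) (a b c d : R) : a < b -> c < d ->
  differentiable_on_rect G a b c d -> rect_integral G a b c d = RtoC 0.
Proof.
intros Hab Hcd H; apply Cmod_eq_0, Rle_antisym; [|apply Cmod_ge_0].
apply le_epsilon; intros eps He; rewrite Rplus_0_l.
set (A := b - a); set (B := d - c).
assert (PA : 0 < A) by (unfold A; lra); assert (PB : 0 < B) by (unfold B; lra).
pose (P := fun u v t => Cmod (rect_integral G
  (a + A * u) (a + A * (u + t)) (c + B * v) (c + B * (v + t))) <= eps * t ^ 2).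
assert (HP : P 0 0 1).
2: { unfold P in HP.
     replace (a + A * 0) with a in HP by ring.
     replace (a + A * (0 + 1)) with b in HP by (unfold A; ring).
     replace (c + B * 0) with c in HP by ring.
     replace (c + B * (0 + 1)) with d in HP by (unfold B; ring).
     lra. }
assert (Sub : forall u v t, 0 <= u -> u + t <= 1 -> 0 <= v -> v + t <= 1 ->
  differentiable_on_rect G
    (a + A * u) (a + A * (u + t)) (c + B * v) (c + B * (v + t))).
{ intros u v t u0 u1 v0 v1.
  apply differentiable_on_subrect with a b c d; trivial;
    unfold A, B in *; nra. }
apply square_bisection.
- intros u v t; apply Rle_dec.
- intros u v t Ht u0 u1 v0 v1; unfold P.
  replace (u + t / 2 + t / 2) with (u + t) by field.
  replace (v + t / 2 + t / 2) with (v + t) by field.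
  intros P1 P2 P3 P4.
  assert (a + A * u <= a + A * (u + t / 2) <= a + A * (u + t)) by nra.
  assert (c + B * v <= c + B * (v + t / 2) <= c + B * (v + t)) by nra.
  rewrite (rect_integral_split_x G _ (a + A * (u + t / 2)));
    [|assumption | lra | now apply Sub].
  rewrite (rect_integral_split_y G (a + A * u) _ _ (c + B * (v + t / 2)));
    [|lra | assumption |
      apply differentiable_on_subrect with (5 := Sub u v t u0 u1 v0 v1); lra].
  rewrite (rect_integral_split_y G (a + A * (u + t / 2)) _ _ (c + B * (v + t / 2)));
    [|lra | assumption |
      apply differentiable_on_subrect with (5 := Sub u v t u0 u1 v0 v1); lra].
  apply Rle_trans with (1 := Cmod_triangle _ _).
  eapply Rle_trans.
  { apply Rplus_le_compat; apply Cmod_triangle. }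
  replace (eps * t ^ 2) with (4 * (eps * (t / 2) ^ 2)) by field.
  lra.
- intros p q Hp Hq.
  assert (Hx : a <= a + A * p <= b) by (unfold A in *; nra).
  assert (Hy : c <= c + B * q <= d) by (unfold B in *; nra).
  destruct (H _ _ Hx Hy) as [l Hl].
  assert (PD : 0 < 2 * (A + B) ^ 2)
    by (apply Rmult_lt_0_compat; [|apply pow_lt]; lra).
  assert (Pe : 0 < eps / (2 * (A + B) ^ 2)) by (apply Rdiv_lt_0_compat; lra).
  destruct (proj1 (is_C_derive_eps G _ l) Hl _ Pe) as [r [Hr Hw]].
  exists (r / (A + B)); split; [apply Rdiv_lt_0_compat; lra|].
  intros u v t Ht u0 u1 v0 v1 Hu Hv; unfold P.
  replace (eps * t ^ 2)
    with (2 * (eps / (2 * (A + B) ^ 2)) * ((A + B) * t) ^ 2) by (field; lra).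
  apply rect_integral_small with (a + A * p) (c + B * q) l;
    [nra | nra | now apply Sub | lra | lra|].
  intros w Hwd; apply Hw, Rle_lt_trans with (1 := Hwd).
  replace r with ((A + B) * (r / (A + B))) by (field; lra).
  apply Rmult_lt_compat_l; lra.
Qed.

(** * Circular means and the Schwarz lemma *)

Lemma Cexp_neq_0 (z : C) : Cexp z <> RtoC 0.
Proof. apply Cmod_gt_0; rewrite Cmod_Cexp; apply exp_pos. Qed.

Lemma disc_Cexp (x y : R) : x < 0 -> Defs.disc (Cexp (x, y)).
Proof.
intros Hx; unfold Defs.disc; rewrite Cmod_Cexp, <- exp_0.
now apply exp_increasing.
Qed.

(** 2 pi times the mean of q over the circle of radius e^s. *)
Definition circle_integral (q : C -> C) (s : R) : C :=
  CInt (fun y => q (Cexp (s, y))) 0 (2 * PI).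

Definition holomorphic_off_0 (q : C -> C) : Prop :=
  forall z, z <> RtoC 0 -> Defs.disc z -> ex_C_derive q z.

Lemma differentiable_in_log_coordinates (q : C -> C) (a b c d : R) :
  holomorphic_off_0 q -> b < 0 ->
  differentiable_on_rect (fun z => q (Cexp z)) a b c d.
Proof.
intros Hq Hb x y Hx _.
destruct (Hq (Cexp (x, y))) as [l Hl];
  [apply Cexp_neq_0 | apply disc_Cexp; lra|].
eexists; apply (is_C_derive_comp q Cexp); [exact Hl | apply is_C_derive_Cexp].
Qed.

Lemma ex_circle_integral (q : C -> C) (s : R) : holomorphic_off_0 q -> s < 0 ->
  ex_CInt (fun y => q (Cexp (s, y))) 0 (2 * PI).
Proof.
intros Hq Hs; generalize PI_RGT_0; intros Hpi.
apply (ex_CInt_vertical (fun z => q (Cexp z)) s s 0 (2 * PI)); [lra | lra|].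
now apply differentiable_in_log_coordinates.
Qed.

(** In the coordinates z = e^(x + iy) the annulus becomes the rectangle
    [s1, s2] x [0, 2 pi], whose horizontal sides have the same image. *)
Lemma circle_integral_constant (q : C -> C) (s1 s2 : R) :
  holomorphic_off_0 q -> s1 < s2 -> s2 < 0 ->
  circle_integral q s1 = circle_integral q s2.
Proof.
intros Hq H12 H2; generalize PI_RGT_0; intros Hpi.
assert (H := goursat (fun z => q (Cexp z)) s1 s2 0 (2 * PI) H12 ltac:(lra)
  (differentiable_in_log_coordinates q _ _ _ _ Hq H2)).
unfold rect_integral in H.
rewrite (CInt_ext _ (fun _ => RtoC 0)) in H.
2: { intros x; replace (Cexp (x, 2 * PI)) with (Cexp (x, 0)); [ring|].
     unfold Cexp; simpl; rewrite cos_2PI, sin_2PI, cos_0, sin_0; reflexivity. }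
assert (Z : CInt (fun _ => RtoC 0) s1 s2 = RtoC 0).
{ apply Cmod_eq_0, Rle_antisym; [|apply Cmod_ge_0].
  apply Rle_trans with ((s2 - s1) * 0); [|lra].
  apply Cmod_CInt_le; [lra| |].
  - exact (ex_RInt_const (V := C_R_NormedModule) s1 s2 (RtoC 0)).
  - intros x _; rewrite Cmod_0; lra. }
rewrite Z in H.
assert (E : (circle_integral q s2
  = CInt (fun y => q (Cexp (s2, y)) - q (Cexp (s1, y)))%C 0 (2 * PI)
    + circle_integral q s1)%C).
{ unfold circle_integral; rewrite <- CInt_plus.
  - apply CInt_ext; intros y; ring.
  - apply ex_CInt_minus; apply ex_circle_integral; trivial; lra.
  - apply ex_circle_integral; trivial; lra. }
rewrite E; set (I := CInt _ 0 (2 * PI)) in *.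
replace I with (- Ci * (0 + Ci * I))%C.
- rewrite H; ring.
- replace (- Ci * (0 + Ci * I))%C with (- (Ci * Ci) * I)%C by ring.
  replace (Ci * Ci)%C with (- RtoC 1)%C; [ring|].
  unfold Ci, Cmult, Copp, RtoC; simpl; f_equal; ring.
Qed.

(** The mean of h(z)/z is close to h'(0) on a small circle and at most 1/r on
    the circle of radius r, and these means are equal. *)
Lemma schwarz_derivative (h : C -> C) (l : C) : holomorphic h ->
  (forall z, Defs.disc z -> Defs.disc (h z)) -> h (RtoC 0) = RtoC 0 ->
  is_C_derive h (RtoC 0) l -> Cmod l <= 1.
Proof.
intros Hh Hd H0 Hl; apply le_epsilon; intros eps He.
assert (Pe : 0 < eps / 2) by lra.
destruct (proj1 (is_C_derive_eps h _ l) Hl _ Pe) as [d [Hd0 Hw]].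
pose (q := fun z => (h z * / z)%C).
assert (Hq : holomorphic_off_0 q).
{ intros z z0 Hz; destruct (Hh z Hz) as [m Hm]; eexists.
  apply is_C_derive_mult; [exact Hm | now apply is_C_derive_inv]. }
(* The outer radius e^s2 is 1/(1 + eps/2); the inner radius e^s1 is below the
   radius d where h(z)/z is within eps/2 of l. *)
pose (s2 := - ln (1 + eps / 2)).
assert (L : 0 < ln (1 + eps / 2)) by (rewrite <- ln_1; apply ln_increasing; lra).
pose (s1 := Rmin (s2 - 1) (ln d - 1)).
assert (S1 : s1 <= s2 - 1) by apply Rmin_l.
assert (S2 : s1 <= ln d - 1) by apply Rmin_r.
clearbody s1.
assert (Sd : exp s1 < d) by (rewrite <- (exp_ln d) by lra; apply exp_increasing; lra).
assert (N2 : s2 < 0) by (unfold s2; lra).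
assert (E2 : / exp s2 = 1 + eps / 2)
  by (unfold s2; rewrite exp_Ropp, Rinv_inv, exp_ln; lra).
assert (HPI := PI_RGT_0).
assert (B1 : Cmod (circle_integral q s1 - RtoC (2 * PI - 0) * l)
             <= (2 * PI - 0) * (eps / 2)).
{ apply CInt_near_const; [lra | apply ex_circle_integral; [exact Hq | lra] |].
  intros y _; set (z := Cexp (s1, y)).
  assert (z0 : z <> RtoC 0) by apply Cexp_neq_0.
  assert (Ez : Cmod z = exp s1) by apply Cmod_Cexp.
  assert (Pz := proj1 (Cmod_gt_0 z) z0).
  specialize (Hw z); rewrite H0 in Hw.
  replace (z - 0)%C with z in Hw by ring.
  replace (h z - 0 - l * z)%C with (h z - l * z)%C in Hw by ring.
  replace (q z - l)%C with ((h z - l * z) * / z)%C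
    by (unfold q; field; exact z0).
  rewrite Cmod_mult, Cmod_inv by exact z0.
  apply Rmult_le_reg_r with (1 := Pz).
  rewrite Rmult_assoc, Rinv_l, Rmult_1_r by lra; apply Hw; lra. }
assert (B2 : Cmod (circle_integral q s2) <= (2 * PI - 0) * (1 + eps / 2)).
{ apply Cmod_CInt_le; [lra | apply ex_circle_integral; [exact Hq | lra] |].
  intros y _; unfold q.
  rewrite Cmod_mult, Cmod_inv, Cmod_Cexp by apply Cexp_neq_0.
  cbn [Re fst]; rewrite E2.
  rewrite <- (Rmult_1_l (1 + eps / 2)) at 2; apply Rmult_le_compat_r; [lra|].
  apply Rlt_le, Hd, disc_Cexp, N2. }
rewrite (circle_integral_constant q s1 s2 Hq) in B1 by lra.
set (I := circle_integral q s2) in *.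
rewrite Rminus_0_r in *.
apply Rmult_le_reg_l with (2 * PI); [lra|].
replace (2 * PI * Cmod l) with (Cmod (RtoC (2 * PI) * l))
  by (rewrite Cmod_mult, Cmod_R, Rabs_pos_eq; lra).
replace (RtoC (2 * PI) * l)%C
  with (- (I - RtoC (2 * PI) * l) + I)%C by ring.
apply Rle_trans with (1 := Cmod_triangle _ _); rewrite Cmod_opp; lra.
Qed.

(** * Moebius maps and the Schwarz-Pick inequality *)

(** The automorphism of the disc that sends 0 to a and -a to 0. *)
Definition mobius (a z : C) : C := ((z + a) * / (1 + Cconj a * z))%C.

(** The source of all disc estimates for Moebius maps: dividing by
    |1 + conj(a) z|^2 gives 1 - |mobius a z|^2 in terms of a and z. *)
Lemma mobius_identity (a z : C) :
  Cmod (1 + Cconj a * z) ^ 2 - Cmod (z + a) ^ 2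
  = (1 - Cmod a ^ 2) * (1 - Cmod z ^ 2).
Proof.
rewrite !Cmod2_alt; destruct a as [a1 a2], z as [z1 z2]; simpl; ring.
Qed.

Lemma mobius_modulus_lt (a z : C) : Defs.disc a -> Defs.disc z ->
  Cmod (z + a) < Cmod (1 + Cconj a * z).
Proof.
intros Ha Hz; generalize (mobius_identity a z).
generalize (Rmult_lt_0_compat _ _ (disc_weight_pos a Ha) (disc_weight_pos z Hz)).
generalize (Cmod_ge_0 (z + a)) (Cmod_ge_0 (1 + Cconj a * z)); nra.
Qed.

Lemma mobius_denominator (a z : C) : Defs.disc a -> Defs.disc z ->
  (1 + Cconj a * z)%C <> RtoC 0.
Proof.
intros Ha Hz; apply Cmod_gt_0.
generalize (mobius_modulus_lt a z Ha Hz) (Cmod_ge_0 (z + a)); lra.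
Qed.

Lemma disc_mobius (a z : C) :
  Defs.disc a -> Defs.disc z -> Defs.disc (mobius a z).
Proof.
intros Ha Hz; unfold Defs.disc, mobius.
rewrite Cmod_mult, Cmod_inv by now apply mobius_denominator.
assert (P := proj1 (Cmod_gt_0 _) (mobius_denominator a z Ha Hz)).
apply Rmult_lt_reg_r with (1 := P).
rewrite Rmult_assoc, Rinv_l, Rmult_1_r, Rmult_1_l by lra.
now apply mobius_modulus_lt.
Qed.

Lemma is_C_derive_mobius (a z : C) : Defs.disc a -> Defs.disc z ->
  is_C_derive (mobius a) z
    (RtoC (1 - Cmod a ^ 2) * / ((1 + Cconj a * z) * (1 + Cconj a * z)))%C.
Proof.
intros Ha Hz; assert (N := mobius_denominator a z Ha Hz).
eapply is_C_derive_eq.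
- apply (is_C_derive_mult (fun w => w + a)%C (fun w => / (1 + Cconj a * w))%C).
  + apply is_C_derive_plus; [apply is_C_derive_id | apply is_C_derive_const].
  + apply (is_C_derive_comp Cinv (fun w => 1 + Cconj a * w)%C).
    * apply is_C_derive_inv, N.
    * apply is_C_derive_plus; [apply is_C_derive_const|].
      apply is_C_derive_scal, is_C_derive_id.
- rewrite RtoC_minus, Cmod2_conj; field; exact N.
Qed.

(** Conjugating phi by the Moebius maps that move 0 to z and phi(z) to 0 gives a
    self-map h of the disc with h(0) = 0 and
    h'(0) = (1 - |z|^2) phi'(z) / (1 - |phi(z)|^2). *)
Lemma schwarz_pick (phi : C -> C) (z : C) : holomorphic phi ->
  (forall w, Defs.disc w -> Defs.disc (phi w)) -> Defs.disc z ->
  (1 - Cmod z ^ 2) * Cmod (C_derive phi z) <= 1 - Cmod (phi z) ^ 2.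
Proof.
intros Hphi Hd Hz; set (b := phi z).
assert (Hb : Defs.disc b) by now apply Hd.
assert (Hb' : Defs.disc (- b)) by (unfold Defs.disc; now rewrite Cmod_opp).
assert (Z0 := disc_0).
pose (h := fun w => mobius (- b) (phi (mobius z w))).
assert (Dh : forall w, Defs.disc w ->
  is_C_derive h w
    ((RtoC (1 - Cmod z ^ 2) * / ((1 + Cconj z * w) * (1 + Cconj z * w)))
     * C_derive phi (mobius z w)
     * (RtoC (1 - Cmod (- b) ^ 2)
        * / ((1 + Cconj (- b) * phi (mobius z w))
             * (1 + Cconj (- b) * phi (mobius z w)))))%C).
{ intros w Hw; assert (Hm := disc_mobius z w Hz Hw).
  apply (is_C_derive_comp (mobius (- b)) (fun w => phi (mobius z w))).
  - apply is_C_derive_mobius; [exact Hb' | now apply Hd].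
  - apply (is_C_derive_comp phi (mobius z)).
    + now apply holomorphic_derive.
    + now apply is_C_derive_mobius. }
assert (M0 : mobius z 0 = z)
  by (unfold mobius; field; rewrite Cmult_0_r, Cplus_0_r; apply C1_nz).
assert (Wz := disc_weight_pos z Hz); assert (Wb := disc_weight_pos b Hb).
assert (K := schwarz_derivative h _ (fun w Hw => ex_intro _ _ (Dh w Hw))
  (fun w Hw => disc_mobius _ _ Hb' (Hd _ (disc_mobius _ _ Hz Hw)))
  ltac:(unfold h; rewrite M0; unfold mobius; fold b; ring) (Dh _ Z0)).
rewrite M0 in K; fold b in K.
replace (1 + Cconj z * 0)%C with (RtoC 1) in K by ring.
rewrite Cmod_opp in K.
replace (1 + Cconj (- b) * b)%C with (RtoC (1 - Cmod b ^ 2)) in K.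
2: { rewrite RtoC_minus, Cmod2_conj; destruct b as [b1 b2].
     unfold Cconj, Cmult, Cminus, Cplus, Copp, RtoC; simpl; f_equal; ring. }
assert (NW : RtoC (1 - Cmod b ^ 2) <> RtoC 0)
  by (intros E; apply RtoC_inj in E; lra).
set (t := 1 - Cmod b ^ 2) in *; set (D := C_derive phi z) in *.
replace (RtoC (1 - Cmod z ^ 2) * / (1 * 1) * D * (RtoC t * / (RtoC t * RtoC t)))%C
  with (RtoC (1 - Cmod z ^ 2) * D * / RtoC t)%C in K by (field; exact NW).
rewrite !Cmod_mult, Cmod_inv, !Cmod_R, !Rabs_pos_eq in K by (trivial; lra).
apply Rmult_le_reg_r with (/ t); [now apply Rinv_0_lt_compat|].
rewrite (Rinv_r t) by lra; exact K.
Qed.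

(** * Composition operators on the little Bloch space *)

Lemma disc_open (z w : C) : Defs.disc z -> Cmod (w - z) < 1 - Cmod z ->
  Defs.disc w.
Proof.
unfold Defs.disc; intros Hz Hw.
replace w with ((w - z) + z)%C by ring.
apply Rle_lt_trans with (1 := Cmod_triangle _ _); lra.
Qed.

Lemma is_C_derive_ext_disc (f g : C -> C) (z l : C) : Defs.disc z ->
  (forall w, Defs.disc w -> f w = g w) -> is_C_derive f z l -> is_C_derive g z l.
Proof.
intros Hz E; apply is_C_derive_ext_near with (1 - Cmod z).
- unfold Defs.disc in Hz; lra.
- intros w Hw; apply E, (disc_open z w Hz Hw).
Qed.

(** The chain rule and Schwarz-Pick bound the weight of f o phi at z by the
    weight of f at phi(z). *)
Lemma composition_contracts_seminorm (phi : C -> C) (T : B0 -> B0) (f : B0) :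
  holomorphic phi -> (forall w, Defs.disc w -> Defs.disc (phi w)) ->
  is_composition_operator phi T -> bloch_seminorm (T f) <= bloch_seminorm f.
Proof.
intros Hphi Hd HT; apply bloch_seminorm_le; [apply B0_bloch|].
intros z Hz; apply Rle_trans with (bloch_weight f (phi z)).
2: { apply bloch_weight_le; [apply B0_bloch | now apply Hd]. }
unfold bloch_weight.
rewrite (is_C_derive_unique (T f) z (C_derive phi z * C_derive f (phi z))%C).
- rewrite Cmod_mult, <- Rmult_assoc.
  apply Rmult_le_compat_r; [apply Cmod_ge_0 | now apply schwarz_pick].
- apply is_C_derive_ext_disc with (fun w => f (phi w)); [exact Hz| |].
  + intros w Hw; symmetry; now apply HT.
  + apply is_C_derive_comp; apply holomorphic_derive; trivial.
    * apply B0_bloch.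
    * now apply Hd.
Qed.

(** Cut off outside the disc, as the representation of elements of [B0]
    requires. *)
Definition disc_identity (z : C) : C :=
  if Rlt_dec (Cmod z) 1 then z else RtoC 0.

Lemma is_C_derive_disc_identity (z : C) : Defs.disc z ->
  is_C_derive disc_identity z (RtoC 1).
Proof.
intros Hz; apply is_C_derive_ext_disc with (fun w => w);
  [exact Hz | | apply is_C_derive_id].
intros w Hw; unfold disc_identity; now destruct (Rlt_dec (Cmod w) 1).
Qed.

Lemma bloch_weight_disc_identity (z : C) : Defs.disc z ->
  bloch_weight disc_identity z = 1 - Cmod z ^ 2.
Proof.
intros Hz; unfold bloch_weight.
rewrite (is_C_derive_unique _ z (RtoC 1)) by now apply is_C_derive_disc_identity.
rewrite Cmod_1; ring.
Qed.

Lemma little_bloch_disc_identity : little_bloch disc_identity.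
Proof.
split.
- apply bloch_of_bound with 1.
  + intros z Hz; eexists; now apply is_C_derive_disc_identity.
  + intros z Hz; rewrite bloch_weight_disc_identity by exact Hz.
    generalize (pow2_ge_0 (Cmod z)); lra.
- intros eps; generalize (cond_pos eps); intros He.
  exists (1 - eps / 2); split; [lra|]; intros z Hz Hr.
  rewrite bloch_weight_disc_identity by exact Hz.
  unfold Defs.disc in Hz; generalize (Cmod_ge_0 z); nra.
Qed.

Definition B0_identity : B0.
Proof.
refine (mkB0 disc_identity little_bloch_disc_identity _).
intros z Hz; unfold disc_identity; now destruct (Rlt_dec (Cmod z) 1).
Defined.

Lemma B0_weight_near (f g : B0) (z : C) (eps : R) : Defs.disc z ->
  B0_ball f eps g -> bloch_weight g z < bloch_weight f z + eps.
Proof.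
intros Hz Hfg; set (k := minus g f : B0).
replace g with (B0_plus f k)
  by (apply B0_ext; intros w; unfold k; simpl; ring).
apply Rle_lt_trans with (bloch_weight f z + bloch_weight k z).
- apply bloch_weight_plus; [apply B0_bloch | apply B0_bloch | exact Hz].
- assert (bloch_weight k z <= bloch_seminorm k)
    by (apply bloch_weight_le; [apply B0_bloch | exact Hz]).
  change (Cmod (k (RtoC 0)) + bloch_seminorm k < eps) in Hfg.
  generalize (Cmod_ge_0 (k (RtoC 0))); lra.
Qed.

(* [is_linear] is Coquelicot's notion of bounded linear operator. *)
Theorem theorem3p1 (phi : C -> C) (Hphi : disc_automorphism phi)
  (T : B0_NormedModule -> B0_NormedModule)
  (HT : is_composition_operator phi T) (Hbounded : is_linear T) :
  ~ hypercyclic T.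
Proof.
intros [f Hf]; destruct Hphi as [Hhol [Hdisc _]].
assert (Orbit : forall n, bloch_seminorm (Nat.iter n T f : B0)
  <= bloch_seminorm (f : B0)).
{ induction n as [|n IH]; [apply Rle_refl|].
  apply Rle_trans with (2 := IH).
  now apply (composition_contracts_seminorm phi T (Nat.iter n T f)). }
set (S := bloch_seminorm (f : B0)) in *.
assert (HS : 0 <= S) by apply bloch_seminorm_ge0, B0_bloch.
(* A target whose weight at 0, namely S + 1, exceeds the weights at 0 along the
   orbit by at least 1. *)
destruct (Hf (B0_scal (RtoC (S + 1)) B0_identity) (mkposreal 1 Rlt_0_1))
  as [g [[n ->] Hg]].
assert (K := B0_weight_near _ _ (RtoC 0) 1 disc_0 (B0_ball_sym _ _ _ Hg)).
assert (K' := bloch_weight_le _ _ (B0_bloch (Nat.iter n T f)) disc_0).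
specialize (Orbit n); simpl in K.
rewrite bloch_weight_scal, bloch_weight_disc_identity, Cmod_R in K
  by (apply disc_0 || apply (proj1 little_bloch_disc_identity)).
rewrite Cmod_0, Rabs_pos_eq in K by lra.
assert (K2 := Rlt_le_trans _ _ _ K
  (Rplus_le_compat_r 1 _ _ (Rle_trans _ _ _ K' Orbit))); lra.
Qed.
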